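(* Suppose Assumptions (A1) and (A2) below hold and that $C > C^*$. Then for every nonempty $\mathscr{S} \in \mathcal{A}(k)$, $$\left| \inf_{T \in \mathcal{T}^{1/2}_{\mathscr{S}}} \sup_{\tau \in \mathrm{Lip}_C(\mathbb{R}^d)} \mathcal{R}(T,\mathscr{S},\tau) \;-\; \frac{C}{2}\,\frac{1}{\#\mathcal{S}_P} \sum_{s \in \mathcal{S}_P \setminus \mathscr{S}} \|X_s - X_{N_{\mathscr{S}}(s)}\| \right| \;\le\; B\,\sigma_E\,\frac{\min\{\#(\mathcal{S}_E \cap \mathcal{S}_P),\, k\}}{\#\mathcal{S}_P}.$$
   Context: Sites are indexed by $\mathcal{S}=\{1,\dots,S\}$. $\mathcal{S}_E\subseteq\mathcal{S}$ (experimental sites) has $\mathrm{card}(\mathcal{S}_E)\ge 2$, and $\mathcal{S}_P\subseteq\mathcal{S}$ (policy sites) is nonempty, with $\#\mathcal{S}_P=\mathrm{card}(\mathcal{S}_P)$; the two sets may overlap. Each site $s$ has a covariate vector $X_s\in\mathbb{R}^d$ and a known standard deviation $\sigma_s>0$. $\|\cdot\|$ is the Euclidean norm, and $\mathrm{Lip}_C(\mathbb{R}^d)$ is the set of functions $\tau:\mathbb{R}^d\to\mathbb{R}$ with $|\tau(x)-\tau(x')|\le C\|x-x'\|$ for all $x,x'$, where $C>0$ is known. (A1): the true conditional treatment effect function $\tau$ lies in $\mathrm{Lip}_C(\mathbb{R}^d)$. (A2): $X_s\neq X_{s'}$ for all $s\neq s'$ in $\mathcal{S}$. Fix an integer $1\le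 k<\mathrm{card}(\mathcal{S}_E)$ and set $\mathcal{A}(k)=\{\mathscr{S}\subset\mathcal{S}_E:\mathrm{card}(\mathscr{S})\le k\}$. For a nonempty $\mathscr{S}\in\mathcal{A}(k)$ with elements $\mathscr{S}_1<\dots<\mathscr{S}_m$, the data are $\hat\tau_{\mathscr{S}}=(\hat\tau_{\mathscr{S}_1},\dots,\hat\tau_{\mathscr{S}_m})^\top\sim\mathcal{N}_m(\tau_{\mathscr{S}},\Sigma_{\mathscr{S}})$, where $\tau_{\mathscr{S}}=(\tau(X_{\mathscr{S}_1}),\dots,\tau(X_{\mathscr{S}_m}))^\top$ and $\Sigma_{\mathscr{S}}=\mathrm{diag}(\sigma^2_{\mathscr{S}_1},\dots,\sigma^2_{\mathscr{S}_m})$. A treatment rule is a measurable map $T:\mathbb{R}^m\to[0,1]^{\#\mathcal{S}_P}$ with components $T_s$, $s\in\mathcal{S}_P$. $\mathcal{T}^{1/2}_{\mathscr{S}}$ is the set of treatment rules such that, for every positive definite diagonal matrix $\Sigma$ and every $s\in\mathcal{S}_P$, $\mathbb{E}[T_s(U)]=1/2$ when $U\sim\mathcal{N}_m(0,\Sigma)$. Regret is $\mathcal{R}(T,\mathscr{S},\tau)=\frac{1}{\#\mathcal{S}_P}\sum_{s\in\mathcal{S}_P}\tau(X_s)\big(\mathbf{1}\{\tau(X_s)\ge0\}-\mathbb{E}_{\tau_{\mathscr{S}}}[T_s(\hat\tau_{\mathscr{S}})]\big)$, where the expectation is taken under $\hat\tau_{\mathscr{S}}\sim\mathcal{N}(\tau_{\mathscr{S}},\Sigma_{\mathscr{S}})$.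 For $s\in\mathcal{S}_P$, $N_{\mathscr{S}}(s)\in\mathscr{S}$ is a nearest neighbor of $s$ in $\mathscr{S}$: $\|X_s-X_{N_{\mathscr{S}}(s)}\|\le\|X_s-X_{s'}\|$ for all $s'\in\mathscr{S}$, taking the smallest index when there are ties. $C^*=\max\{\sqrt{\pi/2}\,\sigma_{N_{\mathscr{S}}(s)}/\|X_s-X_{N_{\mathscr{S}}(s)}\| : \mathscr{S}\in\mathcal{A}(k)\text{ nonempty},\ s\in\mathcal{S}_P\setminus\mathscr{S}\}$. $\sigma_E=\max_{s\in\mathcal{S}_E}\sigma_s$. $B=\arg\max_{z\ge0} z\,\Phi(-z)$, where $\Phi$ is the standard normal CDF. *)

(* Defs.v *)
From HB Require Import structures.
From mathcomp Require Import all_boot all_order all_algebra.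
From mathcomp Require Import all_classical all_reals all_analysis.
Set Implicit Arguments. Unset Strict Implicit. Unset Printing Implicit Defensive.
Import Order.TTheory GRing.Theory Num.Theory.
Local Open Scope classical_set_scope.
Local Open Scope ring_scope.

Section defs.
Variable R : realType.

Definition eucl_norm (d : nat) (x : 'I_d -> R) : R := Num.sqrt (\sum_(i < d) x i ^+ 2).
Definition eucl_dist (d : nat) (x y : 'I_d -> R) : R := eucl_norm (fun i => x i - y i).

Definition Lip (d : nat) (C : R) : set (('I_d -> R) -> R) :=
  [set tau | forall x x', `|tau x - tau x'| <= C * eucl_dist x x'].

(* E[f(U)] for U ~ N_n(mu, diag(sd_1^2,...,sd_n^2)), with the parameters
   given as the tuple of pairs (mu_i, sd_i); computed as the iterated
   integral against the independent one-dimensional normal laws. *)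
Fixpoint gauss_exp (n : nat) : n.-tuple (R * R) -> (n.-tuple R -> R) -> R :=
  match n return n.-tuple (R * R) -> (n.-tuple R -> R) -> R with
  | 0 => fun _ f => f [tuple]
  | n'.+1 => fun ps f =>
      Rintegral (normal_prob (thead ps).1 (thead ps).2) setT
        (fun x => gauss_exp (behead_tuple ps) (fun t => f (cons_tuple x t)))
  end.

Definition Phi (x : R) : R := fine (normal_prob 0 1 `]-oo, x]).

Definition is_argmax_B (B : R) : Prop :=
  0 <= B /\ forall z, 0 <= z -> z * Phi (- z) <= B * Phi (- B).

Variables (S d : nat) (X : 'I_S -> 'I_d -> R) (sigma : 'I_S -> R).

(* nearest neighbour of s in Sc, smallest index among ties (default s if Sc empty) *)
Definition nn (Sc : {set 'I_S}) (s : 'I_S) : 'I_S :=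
  odflt s [pick j in Sc | [forall j' in Sc,
     (eucl_dist (X s) (X j) < eucl_dist (X s) (X j')) ||
     ((eucl_dist (X s) (X j) == eucl_dist (X s) (X j')) && (j <= j')%N)]].

Definition data_params (Sc : {set 'I_S}) (tau : ('I_d -> R) -> R)
  : (#|Sc|).-tuple (R * R) :=
  [tuple (tau (X (enum_val i)), sigma (enum_val i)) | i < #|Sc|].

(* treatment rules: T u s is the s-component (s in S_P) *)
Definition rule (Sc : {set 'I_S}) := (#|Sc|).-tuple R -> 'I_S -> R.

Definition rules_half (SP Sc : {set 'I_S}) : set (rule Sc) :=
  [set T : rule Sc | (forall s, s \in SP ->
              measurable_fun setT (fun u : (#|Sc|).-tuple R => (T u s : R))) /\
           (forall s u, s \in SP -> 0 <= T u s <= 1) /\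
           (forall v : 'I_#|Sc| -> R, (forall i, 0 < v i) ->
              forall s, s \in SP ->
              gauss_exp [tuple (0, Num.sqrt (v i)) | i < #|Sc|] (fun u => T u s)
                = 2^-1)].

Definition regret (SP Sc : {set 'I_S}) (T : rule Sc) (tau : ('I_d -> R) -> R) : R :=
  (#|SP|%:R)^-1 * \sum_(s in SP) tau (X s) *
     ((0 <= tau (X s))%R%:R - gauss_exp (data_params Sc tau) (fun u => T u s)).

Definition minimax_regret (SP Sc : {set 'I_S}) (C : R) : \bar R :=
  ereal_inf [set ereal_sup [set (@regret SP Sc T tau)%:E | tau in @Lip d C]
            | T in @rules_half SP Sc].

Definition Cstar (SE SP : {set 'I_S}) (k : nat) : R :=
  \big[Num.max/0]_(Sc : {set 'I_S} | (Sc \subset SE) && (0 < #|Sc| <= k)%N)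
    \big[Num.max/0]_(s in SP :\: Sc)
       (Num.sqrt (pi / 2) * sigma (nn Sc s) / eucl_dist (X s) (X (nn Sc s))).

Definition sigmaE (SE : {set 'I_S}) : R := \big[Num.max/0]_(s in SE) sigma s.

End defs.

(* Main.v *)
(* Lower bound: tau = C * (distance to the sampled sites) is C-Lipschitz and
   vanishes at every sampled site, so each rule with E[T_s(U)] = 1/2 under
   centered normal laws has regret exactly C/2 times the mean distance to the
   nearest sampled site.

   Upper bound: at a sampled site threshold the estimate at 0; this costs at
   most sup_z z Phi(-z) standard deviations.  At an unsampled site, at distance
   r from its nearest sampled neighbour, use Phi(x / g), that is, add noise of
   variance g^2 to the neighbour's estimate before thresholding, with g such
   that the total standard deviation is h = C r sqrt(2 / pi); this is possible
   since C > C*.  With mean effects a at the site and b at its neighbour, where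
   |a - b| <= C r, the worst case is then a = C r, b = 0: writing
   p = 1 / sqrt(2 pi) for the normal density at 0, this follows from
   Phi(t) <= 1/2 + p t and Phi(-t) <= e^(-2 p t) / 2 for t >= 0. *)
Require Import Defs.
From HB Require Import structures.
From mathcomp Require Import all_boot all_order all_algebra.
From mathcomp Require Import all_classical all_reals all_analysis.
From mathcomp Require Import measurable_realfun ring lra.
Set Implicit Arguments. Unset Strict Implicit. Unset Printing Implicit Defensive.
Import Order.TTheory GRing.Theory Num.Theory.
Import numFieldNormedType.Exports.
Local Open Scope classical_set_scope.
Local Open Scope ring_scope.

(** * The normal law and its distribution function *)

Section normal_law.
Context {R : realType}.
Local Notation mu := (@lebesgue_measure R).
Implicit Types (m s t x y : R).

(** The Radon-Nikodym derivative of [normal_prob m s] agrees almost everywhere with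
    [normal_pdf m s], since both integrate to the same measure. *)
Lemma integral_normal_prob m s (f : _ -> \bar R) :
  measurable_fun setT f -> (\int[normal_prob m s]_x `|f x| < +oo)%E ->
  (\int[normal_prob m s]_x f x = \int[mu]_x (f x * (normal_pdf m s x)%:E))%E.
Proof.
move=> mf finf.
rewrite -(Radon_Nikodym_change_of_variables (normal_prob_dominates m s))//=;
  last by apply/integrableP; split.
apply: ae_eq_integral => //.
- apply: emeasurable_funM => //; apply: (measurable_int mu).
  by apply: Radon_Nikodym_integrable; exact: normal_prob_dominates.
- apply: emeasurable_funM => //=; apply/measurable_EFinP.
  exact: measurable_normal_pdf.
- apply: ae_eqe_mul2l => /=.
  rewrite Radon_NikodymE//=; first exact: normal_prob_dominates.
  move=> dom; case: cid => /= h [h1 h2 h3].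
  apply: integral_ae_eq => //=.
  + by apply/measurable_EFinP; exact: measurable_normal_pdf.
  + by move=> E _ mE; rewrite -h3.
Qed.

Lemma normal_pdf_standard m s x : 0 < s ->
  normal_pdf 0 1 ((m - x) / s) / s = normal_pdf m s x.
Proof.
move=> s0.
rewrite !normal_pdfE ?gt_eqF//= /normal_peak /normal_fun subr0 expr1n mul1r.
rewrite -mulrnAr sqrtrM ?sqr_ge0// sqrtr_sqr gtr0_norm// invfM.
rewrite mulrAC [X in X * _]mulrC; congr (_ * expR _).
by field; rewrite gt_eqF.
Qed.

Lemma normal_prob_fin m s (A : set R) : measurable A ->
  normal_prob m s A = (fine (normal_prob m s A))%:E.
Proof. by move=> mA; rewrite fineK// fin_num_measure. Qed.

Lemma normal_prob_nonneg m s : 0 < s ->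
  normal_prob m s `[0, +oo[%classic = (Phi (m / s))%:E.
Proof.
move=> s0; rewrite /Phi -normal_prob_fin//.
have dF : (fun x : R => (m - x) / s)^`()%classic = cst (- s^-1).
  apply/funext => x; rewrite derive1E.
  by rewrite derive_val /= scaler0 !add0r mulrN1 scalerN [_ *: _]mulr1.
(* The endpoint [m / s] is written as the image of 0 under the decreasing substitution
   [(m - x) / s], which standardises the density. *)
rewrite /normal_prob -{2}(subr0 m).
rewrite (@decreasing_ge0_integration_by_substitutiony R (fun x => (m - x) / s)
  (normal_pdf 0 1) 0).
- apply: eq_integral => x _; rewrite dF /= fctE /= opprK.
  by rewrite -(normal_pdf_standard m x s0).
- by move=> x y _ _ xy; rewrite ltr_pM2r ?invr_gt0// ltrD2l ltrN2.
- by rewrite dF => x _; exact: cst_continuous.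
- by rewrite dF; exact: is_cvg_cst.
- by rewrite dF; exact: is_cvg_cst.
- split.
    move=> x _; exact: ex_derive.
  apply: cvg_at_right_filter; apply: cvgMl; apply: cvgB; first exact: cvg_cst.
  exact: cvg_id.
- apply: gt0_cvgMlNy; first by rewrite invr_gt0.
  apply/cvgrNyPle => A; near=> x.
  by rewrite lerBlDl -lerBlDr; near: x; exact: nbhs_pinfty_ge (num_real _).
- apply: continuous_subspaceT; apply: continuous_normal_pdf; exact: oner_neq0.
- by move=> x _; exact: normal_pdf_ge0.
Unshelve. all: by end_near. Qed.

(** The density is even and a point has measure zero, so []-oo, - t]] has the mass of the complement
    of []-oo, t]]. *)
Lemma PhiN t : Phi (- t) = 1 - Phi t.
Proof.
suff : ((Phi t)%:E + (Phi (- t))%:E)%E = 1%E by case=> <-; rewrite addrAC subrr add0r.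
rewrite /Phi -!normal_prob_fin//.
have -> : normal_prob 0 1 `]-oo, - t]%classic = normal_prob 0 1 `]t, +oo[%classic.
  rewrite /normal_prob ge0_integration_by_substitutionNy; first last.
  - by move=> x _; exact: normal_pdf_ge0.
  - apply: continuous_subspaceT; apply: continuous_normal_pdf; exact: oner_neq0.
  rewrite integral_itv_obnd_cbnd; last first.
    apply/measurable_EFinP/measurable_funTS; exact: measurable_normal_pdf.
  apply: eq_integral => x _ /=.
  by rewrite !normal_pdfE ?oner_neq0//= /normal_fun !subr0 sqrrN.
have -> : `]t, +oo[%classic = ~` `]-oo, t]%classic by rewrite setCitvl.
by rewrite probability_setC// addeC subeK// fin_num_measure.
Qed.

Lemma Phi0 : Phi 0 = 2^-1 :> R.
Proof. by have := PhiN 0; rewrite oppr0; lra. Qed.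

Lemma Phi_ge0 t : 0 <= Phi t.
Proof. exact: fine_ge0. Qed.

Lemma Phi_le1 t : Phi t <= 1.
Proof. by have := Phi_ge0 (- t); rewrite PhiN; lra. Qed.

Lemma Phi_nondecreasing : {homo @Phi R : x y / x <= y}.
Proof.
move=> x y xy; rewrite /Phi fine_le ?fin_num_measure//.
by rewrite le_measure ?inE//; apply: subset_itvl; rewrite bnd_simp.
Qed.

Lemma measurable_Phi : measurable_fun setT (@Phi R).
Proof. by apply: nondecreasing_measurable => //; exact: Phi_nondecreasing. Qed.

End normal_law.

(** * Adding independent normal noise *)

Section normal_convolution.
Context {R : realType}.
Local Notation mu := (@lebesgue_measure R).
Implicit Types (m s x y b g : R).

Lemma normal_peakE s : 0 < s -> normal_peak s = s^-1 * normal_peak 1.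
Proof.
move=> s0; rewrite /normal_peak expr1n mul1r -mulrnAr sqrtrM ?sqr_ge0//.
by rewrite sqrtr_sqr gtr0_norm// invfM.
Qed.

(* Completing the square in [x]: the prior N(b, s^2) and the observation noise
   N(x, g^2) yield the marginal N(b, s^2 + g^2) and a Gaussian posterior. *)
Lemma normal_pdf_conjugate b s g x y : 0 < s -> 0 < g ->
  let h := Num.sqrt (s ^+ 2 + g ^+ 2) in
  normal_pdf x g y * normal_pdf b s x =
  normal_pdf b h y *
  normal_pdf ((g ^+ 2 * b + s ^+ 2 * y) / h ^+ 2) (s * g / h) x.
Proof.
move=> s0 g0 h.
have v0 : 0 < s ^+ 2 + g ^+ 2 by rewrite addr_gt0 ?exprn_gt0.
have h0 : 0 < h by rewrite sqrtr_gt0.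
have k0 : 0 < s * g / h by rewrite divr_gt0 ?mulr_gt0.
rewrite !normal_pdfE ?gt_eqF// (normal_peakE s0) (normal_peakE g0).
rewrite (normal_peakE h0) (normal_peakE k0) mulrACA [RHS]mulrACA.
rewrite -!expRD; congr (_ * expR _).
  by field; rewrite !gt_eqF.
rewrite exprMn exprMn exprVn sqr_sqrtr ?ltW//.
by field; rewrite !gt_eqF.
Qed.

Lemma normal_prob_indic m s (A : set R) : measurable A ->
  normal_prob m s A = (\int[mu]_y (normal_pdf m s y * \1_A y)%:E)%E.
Proof.
move=> mA; rewrite /normal_prob integral_mkcond; apply: eq_integral => y _.
by rewrite epatch_indic EFinM.
Qed.

Lemma measurable_normal_pdf2 g :
  0 < g -> measurable_fun setT (fun z : R * R => normal_pdf z.1 g z.2).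
Proof.
move=> g0; under eq_fun do rewrite normal_pdfE ?gt_eqF//.
apply: measurable_funM => //; apply: measurableT_comp => //.
apply: measurable_funM => //; apply: measurableT_comp => //.
by apply: measurable_funX; apply: measurable_funB.
Qed.

(** [Phi (x / g)] is the probability that N(x, g^2) is nonnegative; averaging over x ~ N(b, s^2)
    gives the same probability for the marginal N(b, s^2 + g^2). *)
Lemma Rintegral_Phi_normal b s g : 0 < s -> 0 < g ->
  (\int[normal_prob b s]_x Phi (x / g))%R = Phi (b / Num.sqrt (s ^+ 2 + g ^+ 2)).
Proof.
move=> s0 g0; set h := Num.sqrt _.
have v0 : 0 < s ^+ 2 + g ^+ 2 by rewrite addr_gt0 ?exprn_gt0.
have h0 : 0 < h by rewrite sqrtr_gt0.
have mP : measurable_fun setT (fun x : R => Phi (x / g)).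
  apply: nondecreasing_measurable => // x y xy.
  by apply: Phi_nondecreasing; rewrite ler_pM2r ?invr_gt0.
suff : (\int[normal_prob b s]_x (Phi (x / g))%:E)%E
  = normal_prob b h `[0, +oo[%classic.
  by rewrite normal_prob_nonneg// /Rintegral => ->.
rewrite integral_normal_prob; first last.
- apply: (@le_lt_trans _ _ (\int[normal_prob b s]_x 1)%E).
    apply: ge0_le_integral => //=.
    + by apply/measurable_EFinP; apply: measurableT_comp => //; exact: mP.
    + by move=> x _; rewrite lee_fin ger0_norm ?Phi_le1// Phi_ge0.
  by rewrite integral_cst// mul1e -ge0_fin_numE// fin_num_measure.
- exact/measurable_EFinP.
pose f (z : R * R) :=
  (normal_pdf z.1 g z.2 * \1_`[0, +oo[ z.2 * normal_pdf b s z.1)%:E.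
transitivity (\int[mu]_x \int[mu]_y f (x, y))%E.
  apply: eq_integral => x _; rewrite -normal_prob_nonneg// normal_prob_indic//.
  rewrite -ge0_integralZr//.
  - apply/measurable_EFinP/measurable_funM; last exact: measurable_indic.
    exact: measurable_normal_pdf.
  - by move=> y _; rewrite lee_fin mulr_ge0// normal_pdf_ge0.
  - by rewrite lee_fin normal_pdf_ge0.
rewrite fubini_tonelli; first last.
- move=> z; rewrite lee_fin !mulr_ge0//; exact: normal_pdf_ge0.
- apply/measurable_EFinP/measurable_funM.
    apply: measurable_funM; first exact: measurable_normal_pdf2.
    by apply: measurableT_comp => //; exact: measurable_indic.
  by apply: measurableT_comp => //; exact: measurable_normal_pdf.
rewrite normal_prob_indic//; apply: eq_integral => y _.
(* With the order of integration exchanged, the inner integral is the total mass of the posterior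
   density, namely 1. *)
transitivity (\int[mu]_x ((normal_pdf b h y * \1_`[0%R, +oo[ y)%:E *
 (normal_pdf ((g ^+ 2 * b + s ^+ 2 * y) / h ^+ 2) (s * g / h) x)%:E))%E.
  apply: eq_integral => x _.
  by rewrite /f /= mulrAC normal_pdf_conjugate// -EFinM mulrAC.
rewrite ge0_integralZl//.
- by rewrite integral_normal_pdf mule1.
- apply/measurable_EFinP; exact: measurable_normal_pdf.
- by move=> x _; rewrite lee_fin normal_pdf_ge0.
- by rewrite lee_fin mulr_ge0// normal_pdf_ge0.
Qed.
End normal_convolution.

(** * Linear and exponential bounds on [Phi] *)

Section normal_tail.
Context {R : realType}.
Local Notation mu := (@lebesgue_measure R).
Local Notation p := (@normal_peak R 1).
Implicit Types (t x : R).

Let p_gt0 : 0 < p. Proof. by rewrite normal_peak_gt0 ?oner_neq0. Qed.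

Let pdf01 x : normal_pdf 0 1 x = p * expR (- (x ^+ 2 / 2)).
Proof. by rewrite normal_pdfE ?oner_neq0//= /normal_fun subr0 expr1n mulNr. Qed.

Let PhiD t : 0 <= t ->
  (Phi t)%:E = (2^-1%:E + \int[mu]_(x in `[0%R, t]) (normal_pdf 0 1 x)%:E)%E.
Proof.
move=> t0; rewrite /Phi -normal_prob_fin//.
have -> : `]-oo, t]%classic = `]-oo, 0]%classic `|` `]0, t]%classic.
  by rewrite -itv_bndbnd_setU// ?bnd_simp.
rewrite measureU//=; first last.
  by rewrite -subset0 => x /=; rewrite !in_itv/= => -[x0 /andP[]]; rewrite ltNge x0.
rewrite -Phi0 /Phi -normal_prob_fin//; congr (_ + _)%E.
rewrite -integral_itv_obnd_cbnd//.
apply/measurable_EFinP/measurable_funTS; exact: measurable_normal_pdf.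
Qed.

(** Half the mass lies below 0, and beyond it the density is at most its peak [p]. *)
Lemma Phi_le_linear t : 0 <= t -> Phi t <= 2^-1 + p * t.
Proof.
move=> t0; rewrite -lee_fin PhiD// EFinD leeD2l//.
apply: (@le_trans _ _ (\int[mu]_(x in `[0%R, t]) p%:E)%E).
  apply: ge0_le_integral => //=.
  - by move=> x _; rewrite lee_fin normal_pdf_ge0.
  - apply/measurable_EFinP/measurable_funTS; exact: measurable_normal_pdf.
  - by move=> x _; rewrite lee_fin normal_pdf_ub ?oner_neq0.
rewrite integral_cst//= lebesgue_measure_itv/= lte_fin.
case: ifPn => _; first by rewrite oppr0 adde0 -EFinM.
by rewrite mule0 lee_fin mulr_ge0// ltW.
Qed.

Let half_exponential x : 0 <= x ->
  (2^-1%:E * (exponential_pdf (2 * p) x)%:E = (p * expR (- (2 * p) * x))%:E)%E.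
Proof. by move=> x0; rewrite exponential_pdfE// -EFinM mulrA mulKf. Qed.

(* The density of N(0,1) dominates half the density of the exponential law of
   rate [2 * p] on [0, 4 * p] and is dominated by it afterwards. *)
Lemma Phi_tail t : 0 <= t -> Phi (- t) <= 2^-1 * expR (- (2 * p) * t).
Proof.
rewrite le_eqVlt => /predU1P[<-|t0].
  by rewrite oppr0 Phi0 mulr0 expR0 mulr1.
have r0 : 0 < 2 * p by rewrite mulr_gt0.
have e0 x : (0 <= (exponential_pdf (2 * p) x)%:E)%E.
  by rewrite lee_fin exponential_pdf_ge0// ltW.
have me (D : set R) : measurable_fun D (fun x => (exponential_pdf (2 * p) x)%:E).
  apply/measurable_EFinP/measurable_funTS; exact: measurable_exponential_pdf.
have mn (D : set R) : measurable_fun D (fun x => (normal_pdf 0 1 x)%:E).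
  apply/measurable_EFinP/measurable_funTS; exact: measurable_normal_pdf.
have E0 := exponential_prob_itv0c (2 * p) t0.
(* At [4 * p] the exponent [x ^+ 2 / 2] overtakes [2 * p * x]: below it the masses of [[0, t]] are
   compared, above it the tails. *)
have [t4|t4] := leP t (4 * p).
  rewrite PhiN; suff : 2^-1 + 2^-1 * (1 - expR (- (2 * p) * t)) <= Phi t by lra.
  rewrite -lee_fin (PhiD (ltW t0)) EFinD leeD2l// EFinM EFinB -E0.
  rewrite /exponential_prob -ge0_integralZl//.
  apply: ge0_le_integral => //=.
  - by move=> x _; rewrite mule_ge0.
  - by apply: measurable_funeM; exact: me.
  - exact: mn.
  - move=> x; rewrite in_itv/= => /andP[x0 xt].
    rewrite half_exponential// lee_fin pdf01 ler_pM2l// ler_expR.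
    have : x * x <= x * (4 * p) by rewrite ler_wpM2l// (le_trans xt).
    rewrite expr2; lra.
  exact: me.
rewrite PhiN -lee_fin.
have -> : (1 - Phi t)%:E = normal_prob 0 1 `]t, +oo[%classic.
  by rewrite -setCitvl probability_setC// EFinB /Phi -normal_prob_fin.
(* Subtracting the exponential mass of [[0, t]] from the total mass leaves at most
   [expR (- (2 * p) * t)] for the tail. *)
have : (\int[mu]_(x in `[0%R, t] `|` `]t, +oo[) (exponential_pdf (2 * p) x)%:E
         <= 1)%E.
  rewrite -(integral_exponential_pdf r0); apply: ge0_subset_integral => //=.
    exact: measurableU.
  exact: me.
rewrite ge0_integral_setU//=; first last.
  apply/disj_setPLR => x /=; rewrite !in_itv/= andbT => /andP[_ xt].
  by apply/negP; rewrite -leNgt.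
  exact: me.
move: E0; rewrite /exponential_prob => ->; rewrite -EFinB -leeBrDl// -EFinB subKr => tail_le.
rewrite EFinM; apply: le_trans (lee_wpmul2l _ tail_le); last by rewrite lee_fin invr_ge0.
rewrite -ge0_integralZl//; last exact: me.
apply: ge0_le_integral => //=.
- by move=> x _; rewrite lee_fin normal_pdf_ge0.
- exact: mn.
- by apply: measurable_funeM; exact: me.
- move=> x; rewrite in_itv/= andbT => tx.
  have x0 : 0 <= x by rewrite ltW// (lt_trans t0).
  rewrite half_exponential// lee_fin pdf01 ler_pM2l// ler_expR.
  have : x * (4 * p) <= x * x by rewrite ler_wpM2l// ltW// (lt_trans t4).
  rewrite expr2; lra.
Qed.

End normal_tail.

(** * Worst-case regret at a single site *)

Section one_site_regret.
Context {R : realType}.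
Local Notation p := (@normal_peak R 1).
Implicit Types (a b h s : R).

Let p_gt0 : 0 < p. Proof. by rewrite normal_peak_gt0 ?oner_neq0. Qed.

(** Expresses the constant of [Cstar] through [p]. *)
Lemma normal_peak1V : (2 * p)^-1 = Num.sqrt (pi / 2).
Proof.
rewrite /normal_peak expr1n mul1r invfM invrK.
have -> : pi *+ 2 = 2 ^+ 2 * (pi / 2) :> R by field.
by rewrite sqrtrM ?sqr_ge0// sqrtr_sqr ger0_norm// mulKf.
Qed.

(** After rescaling, the claim is [w * Phi (- t) <= 2^-1] under [w <= 1 + 2 * p * t]. For [t >= 0]
    the exponential tail cancels [1 + 2 * p * t <= expR (2 * p * t)]; for [t < 0] the linear bound
    suffices. *)
Let le_Phi a b h : 0 < h -> 0 <= a -> a <= b + h / (2 * p) ->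
  a * Phi (- (b / h)) <= h / (4 * p).
Proof.
move=> h0 a0 ab; pose t := b / h; pose w := 2 * p * (a / h).
have -> : a = h / (2 * p) * w.
  by rewrite /w; field; rewrite !gt_eqF.
have -> : h / (4 * p) = h / (2 * p) * 2^-1 by field; rewrite gt_eqF.
have c0 : 0 < h / (2 * p) by rewrite divr_gt0// mulr_gt0.
rewrite -mulrA (ler_pM2l c0) -/t.
have w0 : 0 <= w by rewrite /w mulr_ge0 ?divr_ge0 ?mulr_ge0// ltW.
have wt : w <= 1 + 2 * p * t.
  have -> : 1 + 2 * p * t = 2 * p * ((b + h / (2 * p)) / h).
    by rewrite /t; field; rewrite !gt_eqF.
  by rewrite /w ler_pM2l ?mulr_gt0// ler_pM2r// invr_gt0.
have [t0|t0] := leP 0 t.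
  apply: (le_trans (ler_wpM2l w0 (Phi_tail t0))).
  rewrite mulrCA -[leRHS]mulr1 ler_pM2l// mulNr expRN ler_pdivrMr ?expR_gt0//.
  by rewrite mul1r (le_trans wt)// expR_ge1Dx.
have Nt0 : 0 <= - t by rewrite oppr_ge0 ltW.
apply: (le_trans (ler_wpM2l w0 (Phi_le_linear Nt0))).
have q0 : 0 <= p * - t by rewrite mulr_ge0// ltW.
have {}wt : w <= 1 - 2 * (p * - t) by move: wt; rewrite -mulrA; lra.
(* Here [w * (2^-1 + q) <= (1 - 2 * q) * (2^-1 + q) = 2^-1 - 2 * q ^+ 2]. *)
move: (p * - t) q0 wt => q q0 wt; nra.
Qed.

(** Changing the signs of both [a] and [b] reduces negative [a] to [le_Phi]. *)
Lemma regret_unsampled a b h : 0 < h -> `|a - b| <= h / (2 * p) ->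
  a * ((0 <= a)%R%:R - Phi (b / h)) <= h / (4 * p).
Proof.
move=> h0; rewrite ler_distl => /andP[ab1 ab2].
have [a0|a0] := leP 0 a; first by rewrite -PhiN le_Phi.
have -> : b / h = - (- b / h) by rewrite mulNr opprK.
rewrite sub0r mulrN -mulNr; apply: le_Phi => //.
  by rewrite oppr_ge0 ltW.
by rewrite lerNl opprD opprK.
Qed.

(** In units of [s] the maximal regret is [B * Phi (- B)], relaxed to [B] by [Phi (- B) <= 1]. *)
Lemma regret_sampled (B : R) a s : is_argmax_B B -> 0 < s ->
  a * ((0 <= a)%R%:R - Phi (a / s)) <= B * s.
Proof.
move=> [B0 maxB] s0.
have bound z : 0 <= z -> z * Phi (- (z / s)) <= B * s.
  move=> z0; rewrite -ler_pdivrMr// mulrAC.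
  apply: (le_trans (maxB _ _)); first by rewrite divr_ge0// ltW.
  by rewrite ler_piMr// Phi_le1.
have [a0|a0] := leP 0 a; first by rewrite -PhiN bound.
have -> : a / s = - (- a / s) by rewrite mulNr opprK.
by rewrite sub0r mulrN -mulNr bound// oppr_ge0 ltW.
Qed.

End one_site_regret.

(** * Euclidean distance and nearest neighbours *)

Section euclidean_distance.
Context {R : realType} {d : nat}.
Implicit Types (x y z : 'I_d -> R).

Lemma eucl_norm_ge0 x : 0 <= eucl_norm x.
Proof. exact: sqrtr_ge0. Qed.

Lemma sqr_eucl_norm x : eucl_norm x ^+ 2 = \sum_i x i ^+ 2.
Proof. by rewrite sqr_sqrtr// sumr_ge0// => i _; exact: sqr_ge0. Qed.

Lemma eucl_norm_eq0 x : eucl_norm x = 0 -> forall i, x i = 0.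
Proof.
move=> x0 i; have /eqP := sqr_eucl_norm x; rewrite x0 expr0n eq_sym.
rewrite psumr_eq0 => [/allP/(_ i)|j _]; last exact: sqr_ge0.
by rewrite mem_index_enum sqrf_eq0 => /(_ isT)/eqP.
Qed.

Lemma eucl_CauchySchwarz x y :
  \sum_i x i * y i <= eucl_norm x * eucl_norm y.
Proof.
have [x0|x0] := eqVneq (eucl_norm x) 0.
  by rewrite x0 mul0r big1// => i _; rewrite eucl_norm_eq0// mul0r.
have [y0|y0] := eqVneq (eucl_norm y) 0.
  by rewrite y0 mulr0 big1// => i _; rewrite [y i]eucl_norm_eq0// mulr0.
set a := eucl_norm x; set b := eucl_norm y.
have ab0 : 0 < a * b by rewrite mulr_gt0// lt0r ?x0 ?y0 eucl_norm_ge0.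
(* Scaled by [2 * (a * b)], the claim is the sum over [i] of [0 <= (b * x i - a * y i) ^+ 2]. *)
rewrite -(ler_pM2l ab0) -(ler_pM2l (ltr0n R 2)).
have -> : 2 * (a * b * (a * b)) =
    \sum_i (b ^+ 2 * x i ^+ 2 + a ^+ 2 * y i ^+ 2).
  rewrite big_split/= -!mulr_sumr -!sqr_eucl_norm -/a -/b; ring.
rewrite !mulr_sumr; apply: ler_sum => i _.
by have := sqr_ge0 (b * x i - a * y i); nra.
Qed.

Lemma ler_eucl_normD x y :
  eucl_norm (fun i => x i + y i) <= eucl_norm x + eucl_norm y.
Proof.
rewrite -(@ler_pXn2r _ 2)// ?nnegrE ?addr_ge0 ?eucl_norm_ge0//.
rewrite sqrrD !sqr_eucl_norm.
under eq_bigr do rewrite sqrrD.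
rewrite !big_split/= lerD2r lerD2l -mulr2n lerMn2r/=.
exact: eucl_CauchySchwarz.
Qed.

Lemma eucl_dist_ge0 x y : 0 <= eucl_dist x y.
Proof. exact: eucl_norm_ge0. Qed.

Lemma eucl_distC x y : eucl_dist x y = eucl_dist y x.
Proof.
by congr Num.sqrt; apply: eq_bigr => i _; rewrite -sqrrN opprB.
Qed.

Lemma eucl_distxx x : eucl_dist x x = 0.
Proof.
rewrite /eucl_dist /eucl_norm big1 ?sqrtr0// => i _.
by rewrite subrr expr0n.
Qed.

Lemma eucl_dist_gt0 x y : x <> y -> 0 < eucl_dist x y.
Proof.
move=> xy; rewrite lt0r eucl_dist_ge0 andbT; apply/eqP => /eucl_norm_eq0 d0.
by apply: xy; apply/funext => i; apply/eqP; rewrite -subr_eq0; apply/eqP/d0.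
Qed.

Lemma eucl_dist_triangle y x z :
  eucl_dist x z <= eucl_dist x y + eucl_dist y z.
Proof.
have -> : eucl_dist x z = eucl_norm (fun i => (x i - y i) + (y i - z i)).
  by congr eucl_norm; apply/funext => i; rewrite addrA subrK.
exact: ler_eucl_normD.
Qed.

Lemma LipP (C : R) (tau : ('I_d -> R) -> R) :
  (forall x y, tau x <= tau y + C * eucl_dist x y) -> Lip C tau.
Proof.
move=> H x y; rewrite ler_distl H andbT lerBlDr eucl_distC; exact: H.
Qed.

Variables (S : nat) (X : 'I_S -> 'I_d -> R) (A : {set 'I_S}) (j0 : 'I_S).
Hypothesis j0A : j0 \in A.

(** Unlike [nn], this is defined at every covariate vector, as a member of [Lip C] has to be. *)
Definition set_dist x : R :=
  eucl_dist x (X [arg min_(j < j0 in A) eucl_dist x (X j)]%O).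

Lemma set_dist_le j x : j \in A -> set_dist x <= eucl_dist x (X j).
Proof. by rewrite /set_dist; case: arg_minP => // i _ + jA; apply. Qed.

Lemma set_dist_attained x : exists2 j, j \in A & set_dist x = eucl_dist x (X j).
Proof. by rewrite /set_dist; case: arg_minP => // i iA _; exists i. Qed.

(** By the triangle inequality, the site nearest to [y] is within [eucl_dist x y + set_dist y] of
    [x]. *)
Lemma Lip_set_dist (C : R) : 0 <= C -> Lip C (fun x => C * set_dist x).
Proof.
move=> C0; apply: LipP => x y; rewrite -mulrDr ler_wpM2l//.
have [j jA ->] := set_dist_attained y.
apply: (le_trans (set_dist_le x jA)).
by rewrite addrC eucl_dist_triangle.
Qed.

Lemma nnP s : nn X A s \in A /\
  forall j, j \in A -> eucl_dist (X s) (X (nn X A s)) <= eucl_dist (X s) (X j).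
Proof.
rewrite /nn; case: pickP => [j /andP[jA /forallP jmin]|none] /=.
  split=> // i iA; have := jmin i; rewrite iA/=.
  by case/orP => [/ltW//|/andP[/eqP->]].
have [i iA imin] : exists2 i, i \in A & forall j, j \in A ->
    eucl_dist (X s) (X i) <= eucl_dist (X s) (X j).
  by case: (@arg_minP _ _ _ j0 (mem A) (fun j => eucl_dist (X s) (X j)) j0A)
    => i; exists i.
(* The smallest index among the sites at minimal distance passes the test in [nn], so the default of
   [odflt] never occurs. *)
pose P j := (j \in A) && (eucl_dist (X s) (X j) == eucl_dist (X s) (X i)).
have Pi : P i by rewrite /P iA eqxx.
case: (@arg_minnP _ i P val Pi) => j /andP[jA /eqP ji] jmin.
have := none j; rewrite jA/= => /negbT/negP[]; apply/forallP => l.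
apply/implyP => lA; rewrite ji; have := imin l lA; rewrite le_eqVlt.
case/predU1P => [il|->//]; apply/orP; right; rewrite il eqxx/= jmin//.
by rewrite /P lA il eqxx.
Qed.

Lemma set_dist_nn s : set_dist (X s) = eucl_dist (X s) (X (nn X A s)).
Proof.
have [nnA nnmin] := nnP s; apply: le_anti; rewrite set_dist_le//=.
by have [j jA ->] := set_dist_attained (X s); exact: nnmin.
Qed.

Hypothesis X_inj : forall s s' : 'I_S, s <> s' -> X s <> X s'.

Lemma nn_id s : s \in A -> nn X A s = s.
Proof.
move=> sA; have [nnA nnmin] := nnP s; apply: contrapT => /nesym ns.
have := eucl_dist_gt0 (X_inj ns); rewrite ltNge => /negP; apply.
by rewrite -(eucl_distxx (X s)) nnmin.
Qed.

Lemma nn_dist_gt0 s : s \notin A -> 0 < eucl_dist (X s) (X (nn X A s)).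
Proof.
move=> sA; have [nnA _] := nnP s; apply: eucl_dist_gt0; apply: X_inj => sn.
by move: sA; rewrite {1}sn nnA.
Qed.

End euclidean_distance.

(** * Gaussian expectations of functions of one coordinate *)

Section gaussian_expectation.
Context {R : realType}.
Implicit Types (b v g : R).

Lemma Rintegral_cst_normal b v (r : R) :
  (\int[normal_prob b v]_x r)%R = r.
Proof. by rewrite Rintegral_cst//= probability_setT mulr1. Qed.

Lemma gauss_exp_cst n (ps : n.-tuple (R * R)) (r : R) :
  gauss_exp ps (fun=> r) = r.
Proof.
elim: n => [|n IH] in ps *; first by [].
rewrite /= -[RHS](Rintegral_cst_normal (thead ps).1 (thead ps).2).
by congr Rintegral; apply/funext => x; exact: IH.
Qed.

(** Every other layer of the iterated integral averages a constant under a probability. *)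
Lemma gauss_exp_tnth n (ps : n.-tuple (R * R)) (i : 'I_n) (f : R -> R) :
  gauss_exp ps (fun u => f (tnth u i)) =
  (\int[normal_prob (tnth ps i).1 (tnth ps i).2]_x f x)%R.
Proof.
elim: n => [|n IH] in ps i *; first by case: i.
case/tupleP: ps => q ps /=; rewrite theadE.
have -> : behead_tuple [tuple of q :: ps] = ps by exact: val_inj.
have [j ->|->] := unliftP ord0 i.
  rewrite tnthS -[RHS](Rintegral_cst_normal q.1 q.2).
  congr Rintegral; apply/funext => x; rewrite -IH; congr gauss_exp.
  by apply/funext => t; rewrite tnthS.
congr Rintegral; apply/funext => x; rewrite -[RHS](gauss_exp_cst ps).
by congr gauss_exp; apply/funext => t; rewrite tnth0.
Qed.

Lemma Rintegral_step_normal b v : 0 < v ->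
  (\int[normal_prob b v]_x (0 <= x)%R%:R)%R = Phi (b / v).
Proof.
move=> v0; rewrite /Rintegral.
under eq_integral.
  move=> x _; rewrite (_ : (0 <= x)%R%:R = \1_`[0%R, +oo[ x :> R); last first.
    by rewrite indicE mem_setE in_itv/= andbT.
  over.
by rewrite integral_indic//= setIT normal_prob_nonneg.
Qed.

Lemma measurable_step : measurable_fun setT (fun x : R => (0 <= x)%R%:R : R).
Proof.
apply: nondecreasing_measurable => // x y xy.
by rewrite ler_nat; case: (leP 0 x) => // x0; rewrite (le_trans x0).
Qed.

End gaussian_expectation.

(** * Least favourable effect and smoothed nearest-neighbour rule *)

Section minimax.
Context {R : realType} {S d : nat}.
Variables (X : 'I_S -> 'I_d -> R) (sigma : 'I_S -> R) (C : R).
Variables (SP A : {set 'I_S}) (j0 : 'I_S).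
Hypothesis sigma_gt0 : forall s, 0 < sigma s.
Hypothesis C_gt0 : 0 < C.
Hypothesis j0A : j0 \in A.
Hypothesis X_inj : forall s s' : 'I_S, s <> s' -> X s <> X s'.
Local Notation p := (@normal_peak R 1).
Local Notation r s := (eucl_dist (X s) (X (nn X A s))).

Let p_gt0 : 0 < p. Proof. by rewrite normal_peak_gt0 ?oner_neq0. Qed.

Lemma nn_dist0 s : s \in A -> r s = 0.
Proof. by move=> sA; rewrite (nn_id j0A X_inj sA) eucl_distxx. Qed.

Lemma regret_set_dist (T : rule R A) : rules_half SP T ->
  regret X sigma SP T (fun x => C * set_dist X A j0 x) =
  C / 2 * (#|SP|%:R)^-1 * \sum_(s in SP :\: A) r s.
Proof.
move=> [_ [_ half]]; set tau := fun x => _.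
(* The means vanish because sampled sites are at distance 0; [sigma] becomes a square root to match
   the variances [v] of [rules_half]. *)
have data0 : data_params X sigma A tau =
    [tuple (0, Num.sqrt (sigma (enum_val i) ^+ 2)) | i < #|A|].
  apply: eq_from_tnth => i; rewrite !tnth_mktuple; congr (_, _); last first.
    by rewrite sqrtr_sqr gtr0_norm.
  by rewrite /tau set_dist_nn// nn_dist0 ?mulr0// enum_valP.
rewrite /regret -mulrA mulrCA; congr (_ * _).
rewrite (big_setID A)/= [X in X + _]big1 ?add0r => [|s]; last first.
  by rewrite inE => /andP[_ sA]; rewrite /tau set_dist_nn// nn_dist0// mulr0 mul0r.
rewrite mulr_sumr; apply: eq_bigr => s; rewrite inE => /andP[_ sP].
rewrite data0 (half (fun i => sigma (enum_val i) ^+ 2))//; last first.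
  by move=> i; rewrite exprn_gt0.
rewrite /tau set_dist_nn// mulr_ge0 ?eucl_dist_ge0 ?ltW//=.
by field.
Qed.

Hypothesis C_large : forall s, s \in SP -> s \notin A ->
  Num.sqrt (pi / 2) * sigma (nn X A s) / r s < C.

Let h s := 2 * p * (C * r s).
Let g s := Num.sqrt (h s ^+ 2 - sigma (nn X A s) ^+ 2).

(** This is [C_large] rewritten with [normal_peak1V]: it leaves room for added noise. *)
Let h_gt_sigma s : s \in SP -> s \notin A -> sigma (nn X A s) < h s.
Proof.
move=> sP sA; have r0 := nn_dist_gt0 j0A X_inj sA.
have := C_large sP sA; rewrite -normal_peak1V ltr_pdivrMr//.
by rewrite mulrC ltr_pdivrMr ?mulr_gt0// mulrC.
Qed.

(** [Num.sqrt] is 0 on negative numbers, so the radicand must be shown positive. *)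
Let g_gt0 s : s \in SP -> s \notin A -> 0 < g s.
Proof.
move=> sP sA; rewrite sqrtr_gt0 subr_gt0.
have := h_gt_sigma sP sA; have := sigma_gt0 (nn X A s).
by move=> s0 sh; rewrite ltr_pXn2r// nnegrE ltW// (lt_trans s0).
Qed.

Definition nn_index s := enum_rank_in j0A (nn X A s).

(* Randomising at an unsampled site with Gaussian noise of variance [g s ^+ 2]
   raises the standard deviation of the nearest observation to [h s], the value
   for which the worst-case regret, [C * r s / 2], is attained when tau vanishes
   at the nearest sampled site. *)
Definition smoothed_nn_rule : rule R A := fun u s =>
  let x := tnth u (nn_index s) in
  if s \in A then (0 <= x)%R%:R else Phi (x / g s).

(** Arbitrary parameters [ps] cover both the centered laws of [rules_half] and the data law of
    [regret]. *)
Lemma gauss_exp_smoothed_nn s (ps : (#|A|).-tuple (R * R)) :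
  s \in SP -> 0 < (tnth ps (nn_index s)).2 ->
  gauss_exp ps (fun u => smoothed_nn_rule u s) =
  Phi ((tnth ps (nn_index s)).1 /
    if s \in A then (tnth ps (nn_index s)).2
    else Num.sqrt ((tnth ps (nn_index s)).2 ^+ 2 + g s ^+ 2)).
Proof.
rewrite /smoothed_nn_rule => sP; case: (boolP (s \in A)) => sA v0 /=.
  by rewrite (gauss_exp_tnth _ _ (fun x : R => (0 <= x)%R%:R : R)) Rintegral_step_normal.
rewrite (gauss_exp_tnth _ _ (fun x => Phi (x / g s))) Rintegral_Phi_normal//.
exact: g_gt0.
Qed.

Lemma rules_half_smoothed_nn : rules_half SP smoothed_nn_rule.
Proof.
split; [|split].
- move=> s sP; rewrite /smoothed_nn_rule; case: (boolP (s \in A)) => sA /=.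
    exact: (measurableT_comp measurable_step (measurable_tnth _)).
  apply: (measurableT_comp measurable_Phi); apply: measurable_funM => //.
  exact: measurable_tnth.
- move=> s u _; rewrite /smoothed_nn_rule; case: ifPn => _.
    by rewrite ler0n lern1 leq_b1.
  by rewrite Phi_ge0 Phi_le1.
- move=> v v0 s sP; rewrite gauss_exp_smoothed_nn ?tnth_mktuple ?sqrtr_gt0//=.
  by rewrite mul0r Phi0.
Qed.

Lemma regret_smoothed_nn (B sB : R) tau : is_argmax_B B ->
  (forall s, s \in A -> sigma s <= sB) -> Lip C tau ->
  regret X sigma SP smoothed_nn_rule tau <=
  C / 2 * (#|SP|%:R)^-1 * (\sum_(s in SP :\: A) r s)
  + B * sB * #|SP :&: A|%:R / #|SP|%:R.
Proof.
move=> HB sBP Ltau; rewrite /regret.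
have rkE s : enum_val (nn_index s) = nn X A s.
  by rewrite enum_rankK_in//; case: (nnP X j0A s).
rewrite [leRHS](_ : _ = (#|SP|%:R)^-1 *
   (\sum_(s in SP :&: A) B * sB + \sum_(s in SP :\: A) C / 2 * r s)); last first.
  by rewrite sumr_const -mulr_sumr -mulr_natr; ring.
apply: ler_wpM2l; first by rewrite invr_ge0.
rewrite (big_setID A)/=; apply: lerD; apply: ler_sum => s; rewrite inE.
  move=> /andP[sP sA].
  (* A sampled site is its own nearest neighbour, so its own observation is thresholded. *)
  rewrite gauss_exp_smoothed_nn// ?tnth_mktuple//= sA rkE (nn_id j0A X_inj sA).
  apply: (le_trans (regret_sampled _ HB (sigma_gt0 s))).
  by rewrite ler_wpM2l ?sBP//; case: HB.
move=> /andP[sA sP].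
rewrite gauss_exp_smoothed_nn// ?tnth_mktuple//= (negbTE sA) rkE.
have r0 := nn_dist_gt0 j0A X_inj sA.
have h0 : 0 < h s by exact: lt_trans (h_gt_sigma sP sA).
have -> : Num.sqrt (sigma (nn X A s) ^+ 2 + g s ^+ 2) = h s.
  rewrite sqr_sqrtr; last by have := g_gt0 sP sA; rewrite sqrtr_gt0 => /ltW.
  by rewrite addrC subrK sqrtr_sqr gtr0_norm.
have -> : C / 2 * r s = h s / (4 * p) by rewrite /h; field; rewrite gt_eqF.
apply: regret_unsampled => //.
(* As [h s / (2 * p) = C * r s], this is the Lipschitz bound between [s] and its neighbour. *)
by rewrite /h mulrAC divff ?mul1r ?Ltau// mulf_neq0// gt_eqF.
Qed.

End minimax.

Theorem theorem1 (R : realType) (S d : nat) (SE SP : {set 'I_S})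
  (X : 'I_S -> 'I_d -> R) (sigma : 'I_S -> R) (C : R) (k : nat) (B : R) :
  (forall s, 0 < sigma s) -> 0 < C ->
  (2 <= #|SE|)%N -> (0 < #|SP|)%N -> (1 <= k)%N -> (k < #|SE|)%N ->
  (forall s s' : 'I_S, s <> s' -> X s <> X s') ->
  is_argmax_B B ->
  Cstar X sigma SE SP k < C ->
  forall Sc : {set 'I_S}, Sc \subset SE -> (0 < #|Sc|)%N -> (#|Sc| <= k)%N ->
  (`| minimax_regret X sigma SP Sc C
      - (C / 2 * (#|SP|%:R)^-1 *
         \sum_(s in (SP :\: Sc)%SET) eucl_dist (X s) (X (nn X Sc s)))%R%:E |
    <= (B * sigmaE sigma SE * (minn #|SE :&: SP| k)%:R / #|SP|%:R)%R%:E)%E.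
Proof.
move=> sigma_gt0 C_gt0 _ _ _ _ X_inj HB C_large A AE A_gt0 A_le.
have [j0 j0A] : exists j, j \in A by apply/set0Pn; rewrite -card_gt0.
have B0 : 0 <= B by case: HB.
have C_large' s : s \in SP -> s \notin A ->
    Num.sqrt (pi / 2) * sigma (nn X A s) / eucl_dist (X s) (X (nn X A s)) < C.
  move=> sP sA; apply: le_lt_trans C_large; rewrite /Cstar.
  apply: (bigmax_sup A); first by rewrite AE A_gt0.
  by apply: (bigmax_sup s) => //; rewrite inE sA.
have sE s : s \in A -> sigma s <= sigmaE sigma SE.
  move=> sA; apply: (bigmax_sup s) => //; exact: (fintype.subsetP AE).
set L := C / 2 * _ * _; set e := B * _ * _ / _.
have lower : (L%:E <= minimax_regret X sigma SP A C)%E.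
  apply: le_ereal_inf_tmp => _ [T halfT <-].
  rewrite /L -(regret_set_dist sigma_gt0 C_gt0 j0A X_inj halfT).
  apply: ereal_sup_ubound; exists (fun x => C * set_dist X A j0 x) => //.
  exact: Lip_set_dist (ltW C_gt0).
have upper : (minimax_regret X sigma SP A C <= (L + e)%:E)%E.
  apply: ge_ereal_inf.
  exists (ereal_sup [set (regret X sigma SP (smoothed_nn_rule X sigma C j0A) tau)%:E
    | tau in Lip C]).
    exists (smoothed_nn_rule X sigma C j0A) => //.
    exact: (rules_half_smoothed_nn sigma_gt0 j0A X_inj C_large').
  apply: ge_ereal_sup => _ [tau Ltau <-]; rewrite lee_fin.
  apply: le_trans
    (regret_smoothed_nn sigma_gt0 j0A X_inj C_large' HB sE Ltau) _.
  rewrite lerD2l ler_wpM2r ?invr_ge0// ler_wpM2l ?mulr_ge0//.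
    by rewrite (le_trans (ltW (sigma_gt0 j0)))// sE.
  (* [A] lies in [SE] and has at most [k] elements: one fact for each argument of the minimum. *)
  rewrite ler_nat leq_min; apply/andP; split.
    by rewrite finset.setIC subset_leq_card// finset.setSI.
  by rewrite (leq_trans _ A_le)// subset_leq_card// finset.subsetIr.
(* The two real bounds exclude infinite values. *)
move: lower upper; case: (minimax_regret _ _ _ _ _) => [m| |] //.
rewrite !lee_fin => Lm mLe.
by rewrite ler_distl mLe andbT; lra.
Qed.
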